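(* Let $\Lambda$ be a locally convex, row-finite $k$-graph and let $R$ be a commutative ring with $1$. (a) There is an $R$-algebra $\mathrm{KP}_R(\Lambda)$, generated by a Kumjian-Pask $\Lambda$-family $(p,s)$, such that whenever $(Q,T)$ is a Kumjian-Pask $\Lambda$-family in an $R$-algebra $A$, there exists a unique $R$-algebra homomorphism $\pi_{Q,T}:\mathrm{KP}_R(\Lambda)\to A$ such that $\pi_{Q,T}\circ p=Q$ and $\pi_{Q,T}\circ s=T$. For every $r\in R\setminus\{0\}$ and every $v\in\Lambda^0$, we have $rp_v\neq 0$. (b) The subsets $$\mathrm{KP}_R(\Lambda)_n:=\operatorname{span}_R\{s_\alpha s_{\beta^*}:\alpha,\beta\in\Lambda,\ d(\alpha)-d(\beta)=n\}\qquad(n\in\mathbb Z^k)$$ form a $\mathbb Z^k$-grading of $\mathrm{KP}_R(\Lambda)$.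
   Context: $\mathbb N=\{0,1,2,\dots\}$, $k\geq 1$ is an integer, $e_1,\dots,e_k$ is the standard basis of $\mathbb N^k$, and $\leq$ on $\mathbb N^k$ is coordinatewise. A $k$-graph is a countable category $\Lambda$ with a functor $d:\Lambda\to\mathbb N^k$ (degree) satisfying the factorisation property: if $d(\lambda)=m+n$ with $m,n\in\mathbb N^k$, there are unique $\mu,\nu\in\Lambda$ with $d(\mu)=m$, $d(\nu)=n$, $\lambda=\mu\nu$. Morphisms are called paths; the set $\Lambda^0$ of objects (vertices) is identified with the set of paths of degree $0$; $r,s:\Lambda\to\Lambda^0$ are the codomain (range) and domain (source) maps, so $\lambda\mu$ is defined iff $s(\lambda)=r(\mu)$. Write $\Lambda^n=d^{-1}(n)$, $\Lambda^{\neq0}=\Lambda\setminus\Lambda^0$, $v\Lambda=\{\lambda:r(\lambda)=v\}$, $v\Lambda^n=v\Lambda\cap\Lambda^n$. $\Lambda$ is row-finite if every $v\Lambda^n$ is finite. $\Lambda$ is locally convex if for all $v\in\Lambda^0$, $i\neq j$, $\lambda\in v\Lambda^{e_i}$, $\mu\in v\Lambda^{e_j}$, the sets $s(\lambda)\Lambda^{e_j}$ and $s(\mu)\Lambda^{e_i}$ are nonempty. For $n\in\mathbb N^k$, $\Lambda^{\leq n}=\{\lambda\in\Lambda: d(\lambda)\leq n,\text{ and } d(\lambda)_i<n_i\text{ implies } s(\lambda)\Lambda^{e_i}=\emptyset\}$, and $v\Lambda^{\leq n}=v\Lambda\cap\Lambda^{\leq n}$. Kumjian-Pask families: for each $\lambda\in\Lambda^{\neq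 0}$ let $\lambda^*$ be a formal symbol (ghost path), and let $G(\Lambda^{\neq0})=\{\lambda^*:\lambda\in\Lambda^{\neq0}\}$; for $v\in\Lambda^0$ put $v^*=v$. $R$-algebras are associative but need not be unital. A Kumjian-Pask $\Lambda$-family $(P,S)$ in an $R$-algebra $A$ consists of functions $P:\Lambda^0\to A$ and $S:\Lambda^{\neq0}\cup G(\Lambda^{\neq0})\to A$ such that, with the convention $S_v=S_{v^*}=P_v$ for $v\in\Lambda^0$: (KP1) $P_vP_w=\delta_{v,w}P_v$ for $v,w\in\Lambda^0$; (KP2) for $\lambda,\mu\in\Lambda^{\neq0}$ with $r(\mu)=s(\lambda)$: $S_\lambda S_\mu=S_{\lambda\mu}$, $S_{\mu^*}S_{\lambda^*}=S_{(\lambda\mu)^*}$, $P_{r(\lambda)}S_\lambda=S_\lambda=S_\lambda P_{s(\lambda)}$, $P_{s(\lambda)}S_{\lambda^*}=S_{\lambda^*}=S_{\lambda^*}P_{r(\lambda)}$ (the last two for all $\lambda\in\Lambda^{\ne0}$); (KP3$'$) for all $n\in\mathbb N^k\setminus\{0\}$ and $\lambda,\mu\in\Lambda^{\leq n}$: $S_{\lambda^*}S_\mu=\delta_{\lambda,\mu}P_{s(\lambda)}$; (KP4$'$) for all $v\in\Lambda^0$ and $n\in\mathbb N^k\setminus\{0\}$: $P_v=\sum_{\lambda\in v\Lambda^{\leq n}}S_\lambda S_{\lambda^*}$. *)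

(* Defs.v *)
From HB Require Import structures.
From mathcomp Require Import all_boot all_order all_algebra.
From mathcomp Require Import boolp classical_sets functions cardinality fsbigop.

Set Implicit Arguments.
Unset Strict Implicit.
Unset Printing Implicit Defensive.

Import GRing.Theory.

Local Open Scope classical_set_scope.
Local Open Scope ring_scope.

Notation "''N^' k" := {ffun 'I_k -> nat} (at level 8, k at level 2).
Notation "''Z^' k" := {ffun 'I_k -> int} (at level 8, k at level 2).

Definition std_basis (k : nat) (i : 'I_k) : 'N^k := [ffun j => (j == i) : nat].

Definition leNk (k : nat) (m n : 'N^k) : Prop := forall i, (m i <= n i)%N.

Definition diffNk (k : nat) (m n : 'N^k) : 'Z^k :=
  [ffun i => (m i)%:Z - (n i)%:Z].

(* A small category with separate types of objects and of morphisms.  [comp]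
   is a total function, but [comp l m] is only meaningful (and only
   constrained) when [src l = rng m]. *)
Record kgraph (k : nat) := KGraph {
  vertex : countType;
  path : countType;
  rng : path -> vertex;
  src : path -> vertex;
  idp : vertex -> path;
  comp : path -> path -> path;
  deg : path -> 'N^k;
  rng_idp : forall v, rng (idp v) = v;
  src_idp : forall v, src (idp v) = v;
  rng_comp : forall l m, src l = rng m -> rng (comp l m) = rng l;
  src_comp : forall l m, src l = rng m -> src (comp l m) = src m;
  comp_idl : forall l, comp (idp (rng l)) l = l;
  comp_idr : forall l, comp l (idp (src l)) = l;
  comp_assoc : forall l m n, src l = rng m -> src m = rng n ->
    comp l (comp m n) = comp (comp l m) n;
  deg_idp : forall v, deg (idp v) = 0;
  deg_comp : forall l m, src l = rng m -> deg (comp l m) = deg l + deg m;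
  factorisation : forall (l : path) (m n : 'N^k), deg l = m + n ->
    exists! mn : path * path,
      [/\ deg mn.1 = m, deg mn.2 = n, src mn.1 = rng mn.2 & l = comp mn.1 mn.2]
}.

Section KGraphs.
Variables (k : nat) (L : kgraph k).

Definition paths_at (v : vertex L) (n : 'N^k) : set (path L) :=
  [set l | rng l = v /\ deg l = n].

Definition row_finite : Prop := forall v n, finite_set (paths_at v n).

Definition locally_convex : Prop :=
  forall (v : vertex L) (i j : 'I_k) (l m : path L), i != j ->
    paths_at v (std_basis i) l -> paths_at v (std_basis j) m ->
    paths_at (src l) (std_basis j) !=set0 /\
    paths_at (src m) (std_basis i) !=set0.

Definition paths_le (n : 'N^k) : set (path L) :=
  [set l | leNk (deg l) n /\
    forall i, (deg l i < n i)%N -> paths_at (src l) (std_basis i) = set0].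

Definition paths_le_at (v : vertex L) (n : 'N^k) : set (path L) :=
  [set l | rng l = v] `&` paths_le n.

Definition nzpath := {l : path L | deg l != 0}.

(* [inl l] stands for the path l and [inr l] for the ghost path l^* *)
Definition path_or_ghost := (nzpath + nzpath)%type.

End KGraphs.

(* R-algebras need not be unital here, unlike the library's algType. *)
Record nualgebra (R : comPzRingType) := NuAlgebra {
  nucarrier :> lmodType R;
  numul : nucarrier -> nucarrier -> nucarrier;
  numulA : associative numul;
  numulDl : left_distributive numul +%R;
  numulDr : right_distributive numul +%R;
  numulZl : forall (a : R) x y, numul (a *: x) y = a *: numul x y;
  numulZr : forall (a : R) x y, numul x (a *: y) = a *: numul x y
}.

Notation "x ** y" := (numul x y) (at level 40, left associativity) : ring_scope.

Section NuAlgebras.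
Variable R : comPzRingType.

Definition alg_hom (A B : nualgebra R) (f : A -> B) : Prop :=
  linear f /\ forall x y, f (x ** y) = f x ** f y.

Variable A : nualgebra R.

Definition submodule (U : set A) : Prop :=
  [/\ U 0, (forall x y, U x -> U y -> U (x + y)) &
      forall (a : R) x, U x -> U (a *: x)].

Definition subalgebra (U : set A) : Prop :=
  submodule U /\ forall x y, U x -> U y -> U (x ** y).

Definition generates (X : set A) : Prop :=
  forall U : set A, subalgebra U -> X `<=` U -> U = [set: A].

Definition lspan (X : set A) : set A :=
  [set x | exists (n : nat) (c : 'I_n -> R) (g : 'I_n -> A),
     (forall i, X (g i)) /\ x = \sum_(i < n) c i *: g i].

(* A is the internal direct sum of the submodules B n: each element is, in
   exactly one way, the sum of a finitely supported family of homogeneous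
   components. *)
Definition is_grading (k : nat) (B : 'Z^k -> set A) : Prop :=
  [/\ forall n, submodule (B n),
      forall m n x y, B m x -> B n y -> B (m + n) (x ** y) &
      forall x : A, exists! f : 'Z^k -> A,
        [/\ forall n, B n (f n), finite_set [set n | f n != 0] &
            x = \sum_(n \in [set: 'Z^k]) f n]].

End NuAlgebras.

Section KumjianPask.
Variables (k : nat) (L : kgraph k) (R : comPzRingType) (A : nualgebra R).
Variables (P : vertex L -> A) (S : path_or_ghost L -> A).

(* S_l and S_(l^* ) for an arbitrary path l, with S_v = S_(v^* ) = P_v when l
   is (the identity path of) a vertex v, i.e. when l has degree 0. *)
Definition path_elt (l : path L) : A :=
  if insub l is Some e then S (inl e) else P (rng l).

Definition ghost_elt (l : path L) : A :=
  if insub l is Some e then S (inr e) else P (rng l).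

Record KP_family : Prop := KPFamily {
  KP1 : forall v w, P v ** P w = if v == w then P v else 0;
  KP2_path : forall l m, deg l != 0 -> deg m != 0 -> src l = rng m ->
    path_elt l ** path_elt m = path_elt (comp l m);
  KP2_ghost : forall l m, deg l != 0 -> deg m != 0 -> src l = rng m ->
    ghost_elt m ** ghost_elt l = ghost_elt (comp l m);
  KP2_path_vertex : forall l, deg l != 0 ->
    P (rng l) ** path_elt l = path_elt l /\
    path_elt l ** P (src l) = path_elt l;
  KP2_ghost_vertex : forall l, deg l != 0 ->
    P (src l) ** ghost_elt l = ghost_elt l /\
    ghost_elt l ** P (rng l) = ghost_elt l;
  KP3' : forall (n : 'N^k) (l m : path L), n != 0 ->
    paths_le n l -> paths_le n m ->
    ghost_elt l ** path_elt m = if l == m then P (src l) else 0;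
  (* For row-finite L the index set is finite, so this is the actual sum *)
  KP4' : forall (v : vertex L) (n : 'N^k), n != 0 ->
    P v = \sum_(l \in paths_le_at v n) (path_elt l ** ghost_elt l)
}.

Definition KP_component (n : 'Z^k) : set A :=
  lspan [set x | exists a b : path L,
           diffNk (deg a) (deg b) = n /\ x = path_elt a ** ghost_elt b].

End KumjianPask.

Definition KP_universal (k : nat) (L : kgraph k) (R : comPzRingType)
    (K : nualgebra R) (p : vertex L -> K) (s : path_or_ghost L -> K) : Prop :=
  forall (A : nualgebra R) (Q : vertex L -> A) (T : path_or_ghost L -> A),
    KP_family Q T ->
    exists! pi : K -> A, [/\ alg_hom pi, pi \o p = Q & pi \o s = T].

(* Main.v *)
(** The algebra KP consists of formal terms in the vertices, paths and ghost
    paths, modulo equality of values in every Kumjian-Pask family; universality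
    is then immediate.  That r p_v is nonzero follows from the family of partial
    shifts acting on the R-valued functions of boundary paths, since local
    convexity provides a boundary path with range v.  By (KP3') and (KP4'),
    s_{b^*} s_c is a sum of elements s_l s_{m^*} with b l = c m, so the monomials
    s_a s_{b^*} span KP and their products respect degrees.  The sum of the
    components is direct because left multiplication combined with shifting
    functions on Z^k by the degree is again a Kumjian-Pask family, and the
    induced homomorphism recovers the homogeneous components. *)

From HB Require Import structures.
From mathcomp Require Import all_boot all_order all_algebra finmap.
From mathcomp Require Import generic_quotient zify.
From mathcomp Require Import boolp classical_sets functions cardinality fsbigop.
Require Import Defs.

Set Implicit Arguments.
Unset Strict Implicit.
Unset Printing Implicit Defensive.

Import GRing.Theory.

Local Open Scope classical_set_scope.
Local Open Scope ring_scope.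

(** * Factorisation in k-graphs *)

Section KGraphTheory.
Variables (k : nat) (L : kgraph k).
Implicit Types (l a b c : path L) (v : vertex L) (m n : 'N^k) (F : set (path L)).

Lemma addNkE m n i : (m + n) i = (m i + n i)%N.
Proof. by rewrite ffunE. Qed.

Lemma zeroNkE i : (0 : 'N^k) i = 0%N.
Proof. by rewrite ffunE. Qed.

Lemma leNk_subK m n : leNk m n -> n = m + [ffun i => (n i - m i)%N].
Proof. by move=> le_mn; apply/ffunP => i; rewrite addNkE ffunE subnKC. Qed.

(** Cancellation in N^k forces the second factors to have equal degrees as well, and then the
    uniqueness part of the factorisation property applies. *)
Lemma comp_inj a b a' b' : src a = rng b -> src a' = rng b' ->
  deg a = deg a' -> comp a b = comp a' b' -> a = a' /\ b = b'.
Proof.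
move=> ab ab' da E.
have db : deg b = deg b'.
  have := congr1 (@deg _ L) E; rewrite !deg_comp// da => /ffunP dE.
  by apply/ffunP => i; have := dE i; rewrite !addNkE => /addnI.
have [x [_ xU]] := factorisation (deg_comp ab).
have xab : x = (a, b) by apply: xU.
have xab' : x = (a', b') by apply: xU; rewrite /= -da -db.
by case: (etrans (esym xab) xab').
Qed.

Lemma factor l m : leNk m (deg l) ->
  exists a b, [/\ deg a = m, src a = rng b & l = comp a b].
Proof.
move=> /leNk_subK /factorisation[[a b] [[/= da _ ab lE] _]].
by exists a, b.
Qed.

(** Composing l with the identity at its source or at its range gives two factorisations of l whose
    first factors, l and the identity path, both have degree 0. *)
Lemma deg0_idp l : deg l = 0 -> l = idp (rng l).
Proof.
move=> dl; have [||||//] := @comp_inj l (idp (src l)) (idp (rng l)) l.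
- by rewrite rng_idp.
- by rewrite src_idp.
- by rewrite deg_idp.
- by rewrite comp_idl comp_idr.
Qed.

Definition prefix a l := exists2 b, src a = rng b & l = comp a b.

Lemma prefix_refl a : prefix a a.
Proof. by exists (idp (src a)); rewrite ?rng_idp ?comp_idr. Qed.

Lemma prefix_comp a b : src a = rng b -> prefix a (comp a b).
Proof. by exists b. Qed.

Lemma prefix_rng a l : prefix a l -> rng l = rng a.
Proof. by case=> b ab ->; rewrite rng_comp. Qed.

Lemma prefix_trans b a l : prefix a b -> prefix b l -> prefix a l.
Proof.
move=> [c ac ->] [d]; rewrite src_comp// => cd ->.
by exists (comp c d); rewrite ?rng_comp ?comp_assoc.
Qed.

Lemma prefix_compl l a b : src l = rng a -> prefix a b ->
  prefix (comp l a) (comp l b).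
Proof.
by move=> la [c ac ->]; exists c; rewrite ?src_comp ?comp_assoc.
Qed.

Lemma prefix_deg_eq a b l : prefix a l -> prefix b l -> deg a = deg b -> a = b.
Proof. by move=> [c ac ->] [d bd E] ab; case: (comp_inj ac bd ab E). Qed.

(** Cut b at degree [deg a]. The piece obtained is a prefix of l of the same degree as a, so it is
    a. *)
Lemma prefix_le a b l : prefix a l -> prefix b l -> leNk (deg a) (deg b) ->
  prefix a b.
Proof.
move=> al bl /factor[a' [c [da' a'c bE]]].
have -> : a = a' by apply: (prefix_deg_eq al) => //; apply: prefix_trans bl; exists c.
by exists c.
Qed.

Lemma prefix_comp_inv l a b : src l = rng a -> src l = rng b ->
  prefix (comp l a) (comp l b) -> prefix a b.
Proof.
move=> la lb [c]; rewrite src_comp// => ac; rewrite -comp_assoc// => E.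
have [|//|_ ->] := comp_inj lb _ _ E; first by rewrite rng_comp.
by exists c.
Qed.

Definition no_edge v i := paths_at v (std_basis i) = set0.

Lemma std_basis_le i n : (0 < n i)%N -> leNk (std_basis i) n.
Proof. by move=> ni j; rewrite ffunE; case: eqP => // ->. Qed.

Lemma edge_start l i : (0 < deg l i)%N -> exists a b,
  [/\ paths_at (rng l) (std_basis i) a, src a = rng b & l = comp a b].
Proof.
move=> /std_basis_le /factor[a [b [da ab lE]]]; exists a, b.
by split=> //; split=> //; rewrite lE rng_comp.
Qed.

Lemma no_edge_deg l i : no_edge (rng l) i -> deg l i = 0%N.
Proof.
move=> ne; apply/eqP; rewrite -leqn0 leqNgt; apply/negP => /edge_start[a [b []]].
by rewrite ne.
Qed.

(** An edge e in direction i at the source would make [comp l e] a path from [rng l] with positive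
    degree in direction i, and that path could be factored with an edge in direction i first. *)
Lemma no_edge_src l i : no_edge (rng l) i -> no_edge (src l) i.
Proof.
move=> ne; apply/eqP/negPn/negP => /set0P[e [er de]].
have := @no_edge_deg (comp l e) i; rewrite rng_comp// => /(_ ne).
by rewrite deg_comp// addNkE de ffunE eqxx; lia.
Qed.

(** If the composite falls short in direction i, then so does a or b. For b this is its own
    maximality; for a, the lack of edges at [src a] is inherited by the source of b. *)
Lemma paths_le_comp m n a b : src a = rng b -> paths_le m a -> paths_le n b ->
  paths_le (m + n) (comp a b).
Proof.
move=> ab [am amax] [bn bmax]; rewrite /paths_le /= deg_comp// src_comp//.
split=> i; rewrite !addNkE; first by rewrite leq_add.
case: (ltnP (deg b i) (n i)) => [/bmax//|]; move: (am i) (bn i).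
case: (ltnP (deg a i) (m i)) => [/amax|]; last by lia.
by rewrite ab => /no_edge_src.
Qed.

Lemma paths_le_deg l : paths_le (deg l) l.
Proof. by split=> i //; rewrite ltnn. Qed.

Lemma paths_le_tail n l b : src l = rng b -> paths_le (deg l + n) (comp l b) ->
  paths_le n b.
Proof.
move=> lb []; rewrite deg_comp// src_comp// => le max; split=> i.
  by have := le i; rewrite !addNkE leq_add2l.
by move=> lt; apply: max; rewrite !addNkE ltn_add2l.
Qed.

(* A prefix of the common extension that lacks degree in a direction in which
   it may still grow ends at a vertex without edges in that direction. *)
Lemma paths_le_deg_ge n a b l : prefix a l -> prefix b l -> paths_le n a ->
  leNk (deg b) n -> leNk (deg b) (deg a).
Proof.
move=> [c ac ->] [d bd E] [_ amax] bn i; rewrite leqNgt; apply/negP => lt.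
have := congr1 (fun x => deg x i) E; rewrite !deg_comp// !addNkE.
suff -> : deg c i = 0%N by lia.
by apply: no_edge_deg; rewrite -ac; apply: amax; apply: leq_trans (bn i).
Qed.

Lemma paths_le_uniq n a b l : prefix a l -> prefix b l ->
  paths_le n a -> paths_le n b -> a = b.
Proof.
move=> al bl an bn; apply: (prefix_deg_eq al bl); apply/ffunP => i.
apply/eqP; rewrite eqn_leq.
by rewrite (paths_le_deg_ge bl al bn an.1) (paths_le_deg_ge al bl an bn.1).
Qed.

(** Starting from the identity at v, edges are appended as long as the degree stays below n. *)
Lemma paths_le_exists v n : exists2 l, rng l = v & paths_le n l.
Proof.
(* N bounds the total degree that l still lacks. For N = 0 the bound [deg l <= n] must be an
   equality, and each appended edge uses up one unit of N. *)
suff ext N l : leNk (deg l) n -> (\sum_i n i <= \sum_i deg l i + N)%N ->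
    exists2 l', rng l' = rng l & paths_le n l'.
  have [||l' l'v] := ext (\sum_i n i)%N (idp v).
  - by move=> i; rewrite deg_idp zeroNkE.
  - by rewrite leq_addl.
  - by exists l' => //; rewrite l'v rng_idp.
elim: N l => [|N IH] l le sum_le.
  exists l => //; split=> // i lt; exfalso.
  have: (\sum_i deg l i < \sum_i n i)%N.
    rewrite (bigD1 i)//= [X in (_ < X)%N](bigD1 i)//= -addSn leq_add//.
    by apply: leq_sum => j _; exact: le.
  by rewrite ltnNge -[X in (_ <= X)%N]addn0 sum_le.
have [[i lt /set0P[e [er de]]]|noext] := pselect (exists2 i, (deg l i < n i)%N &
    paths_at (src l) (std_basis i) != set0).
  have [||l' l'r] := IH (comp l e); last by exists l'; rewrite // l'r rng_comp.
  - move=> j; rewrite deg_comp// addNkE de ffunE; have := le j.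
    by case: eqP => [->|]; lia.
  - rewrite deg_comp//; under [X in (_ <= X + _)%N]eq_bigr do rewrite addNkE.
    rewrite big_split/= de (leq_trans sum_le)// -addnA leq_add2l -add1n leq_add2r.
    by rewrite (bigD1 i)//= ffunE eqxx.
exists l => //; split=> // i lt; apply/eqP/negPn/negP => ne.
by apply: noext; exists i.
Qed.

(** Only finitely many degrees lie below n, and row-finiteness gives finitely many paths of each.
    The degrees are coded by functions into ['I_N.+1], as N dominates every coordinate of n. *)
Lemma paths_le_at_finite v n : row_finite L -> finite_set (paths_le_at v n).
Proof.
move=> rf; pose N := (\sum_i n i)%N.
pose g (f : {ffun 'I_k -> 'I_N.+1}) : 'N^k := [ffun i => f i : nat].
apply: (@sub_finite_set _ _ (\bigcup_(f in [set: {ffun 'I_k -> 'I_N.+1}])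
   paths_at v (g f))); last by apply: bigcup_finite.
move=> l [lv [le _]]; exists [ffun i => inord (deg l i)] => //; split=> //.
apply/ffunP => i; rewrite !ffunE inordK// ltnS (leq_trans (le i))//.
by rewrite /N (bigD1 i)//= leq_addr.
Qed.

(** * Truncation of paths under local convexity *)

Section LocallyConvex.
Hypothesis lc : locally_convex L.

(** Induction on the total degree of l. The first edge of l has a direction j different from i,
    since l has degree 0 in direction i; local convexity then carries the edge in direction i from
    the range of that first edge to its source. *)
Lemma edge_transport l i : deg l i = 0%N ->
  paths_at (rng l) (std_basis i) !=set0 -> paths_at (src l) (std_basis i) !=set0.
Proof.
elim: {l}(\sum_j deg l j)%N {-2}l (leqnn (\sum_j deg l j)%N) => [|N IH] l.
  rewrite leqn0 sum_nat_eq0 => /forallP/= dl _.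
  have /deg0_idp -> : deg l = 0.
    by apply/ffunP => j; rewrite zeroNkE; apply/eqP; exact: dl.
  by rewrite src_idp rng_idp.
move=> dl li [e er]; have [[j lj]|no] := pselect (exists j, (0 < deg l j)%N).
  have [a [b [ar ab lE]]] := edge_start lj.
  have ij : i != j by apply/eqP => ijE; rewrite -ijE li in lj.
  move: dl li er ar; rewrite {}lE deg_comp// src_comp// rng_comp//.
  under eq_bigr do rewrite addNkE.
  rewrite big_split/= addNkE => dl li er ar; apply: IH; last 2 first.
  - by lia.
  - by rewrite -ab; have [] := lc ij er ar.
  rewrite -ltnS (leq_trans _ dl)// -add1n leq_add2r.
  by rewrite (bigD1 j)//= ar.2 ffunE eqxx.
have /deg0_idp lE : deg l = 0.
  by apply/ffunP => j; rewrite zeroNkE; apply/eqP; rewrite -leqn0 leqNgt;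
     apply/negP => ?; apply: no; exists j.
by rewrite lE src_idp; exists e.
Qed.

(** Truncate l at the coordinatewise minimum of m and [deg l]. Where the truncation a falls short of
    m, it already has the full degree of l in that direction. An edge at [src a] could then be
    transported along the rest of l to [src l], against the maximality of l. *)
Lemma paths_le_prefix m n l : leNk m n -> paths_le n l ->
  exists2 a, prefix a l & paths_le m a.
Proof.
move=> mn [ln lmax].
have [|a [b [da ab lE]]] := @factor l [ffun i => minn (m i) (deg l i)].
  by move=> i; rewrite ffunE geq_minr.
exists a; first by exists b.
split=> i; rewrite da ffunE; first exact: geq_minl.
rewrite gtn_min ltnn /= => lm; apply/eqP/negPn/negP => /set0P.
rewrite ab => ne; have [|e] := @edge_transport b i _ ne.
  have := congr1 (fun x => deg x i) lE; rewrite deg_comp// addNkE da ffunE.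
  by lia.
suff -> : paths_at (src b) (std_basis i) = set0 by [].
by have := lmax i (leq_trans lm (mn i)); rewrite {1}lE src_comp.
Qed.

End LocallyConvex.
End KGraphTheory.

(** * Boundary paths *)

Section BoundaryPaths.
Variables (k : nat) (L : kgraph k).
Implicit Types (l a b c : path L) (v : vertex L) (m n : 'N^k) (F : set (path L)).

(* A boundary path is encoded as the set of its finite initial segments. *)
Record boundary F : Prop := Boundary {
  boundary_prefix : forall a l, prefix a l -> F l -> F a;
  boundary_directed : forall a b, F a -> F b ->
    exists2 l, F l & prefix a l /\ prefix b l;
  boundary_meets : forall n, exists2 l, F l & paths_le n l
}.

(** [extend l F] is the boundary path l F, closed under prefixes because only the initial segments
    of l F that contain l have the form [comp l b]. [shift l F] is what remains of F once its
    initial segment l is removed. *)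
Definition extend l F : set (path L) :=
  [set a | exists b, [/\ F b, src l = rng b & prefix a (comp l b)]].

Definition shift l F : set (path L) :=
  [set a | src l = rng a /\ F (comp l a)].

Lemma boundary_rng F a b : boundary F -> F a -> F b -> rng a = rng b.
Proof.
by move=> [_ dir _] Fa Fb; have [l _ [/prefix_rng <- /prefix_rng <-]] := dir _ _ Fa Fb.
Qed.

Lemma boundary_idp F a : boundary F -> F a -> F (idp (rng a)).
Proof.
by move=> [pre _ _] Fa; apply: pre Fa; exists a; rewrite ?src_idp ?comp_idl.
Qed.

Lemma boundary_idp_rng F v a : boundary F -> F (idp v) -> F a -> rng a = v.
Proof. by move=> bF Fv Fa; rewrite (boundary_rng bF Fa Fv) rng_idp. Qed.

Lemma boundary_uniq F n a b : boundary F -> F a -> F b ->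
  paths_le n a -> paths_le n b -> a = b.
Proof.
by move=> bF Fa Fb; have [l _ [al bl]] := boundary_directed bF Fa Fb;
   exact: (paths_le_uniq al bl).
Qed.

Lemma boundary_meets_at F v n : boundary F -> F (idp v) ->
  exists2 a, F a & paths_le_at v n a.
Proof.
move=> bF Fv; have [a Fa an] := boundary_meets bF n; exists a => //.
by split=> //=; exact: boundary_idp_rng Fa.
Qed.

Lemma boundary_shift F l : boundary F -> F l -> boundary (shift l F).
Proof.
move=> bF Fl; have [pre dir meets] := bF; split.
- move=> a b ab [lb Fb]; have la : src l = rng a by rewrite lb (prefix_rng ab).
  by split=> //; apply: pre Fb; apply: prefix_compl.
- move=> a b [la Fa] [lb Fb]; have [c Fc [[a' aa' cE] [b' bb' cE']]] := dir _ _ Fa Fb.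
  move: aa' bb' cE cE'; rewrite !src_comp// => aa' bb'; rewrite -!comp_assoc//.
  move=> cE cE'; have laa : src l = rng (comp a a') by rewrite rng_comp.
  have lbb : src l = rng (comp b b') by rewrite rng_comp.
  (* Cancelling l turns the common extension of l a and l b into one of a and b. *)
  have [_ E] := comp_inj laa lbb (erefl _) (etrans (esym cE) cE').
  exists (comp a a'); first by split; rewrite ?rng_comp -?cE.
  by split; [exists a' | rewrite E; exists b'].
(* The element a chosen for the bound [deg l + n] has a common extension with l, so its degree is at
   least [deg l]. Hence l is a prefix of a, and the tail satisfies the bound n. *)
- move=> n; have [a Fa an] := meets (deg l + n).
  have [c Fc [lc ac]] := dir _ _ Fl Fa.
  have [|d ld aE] := prefix_le lc ac.
    by apply: (paths_le_deg_ge ac lc an) => i; rewrite addNkE leq_addr.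
  exists d; first by split; rewrite -?aE.
  by apply: (paths_le_tail ld); rewrite -aE.
Qed.

Lemma shift_idp F l : F l -> shift l F (idp (src l)).
Proof. by move=> Fl; split; rewrite ?rng_idp ?comp_idr. Qed.

Lemma extend_self F l : F (idp (src l)) -> extend l F l.
Proof.
move=> Fl; exists (idp (src l)); split; rewrite ?rng_idp ?comp_idr//.
exact: prefix_refl.
Qed.

Lemma extendK F l : boundary F -> F (idp (src l)) -> shift l (extend l F) = F.
Proof.
move=> bF Fl; apply/seteqP; split=> a.
  move=> [la [b [Fb lb ab]]]; apply: (boundary_prefix bF) Fb.
  exact: (prefix_comp_inv la lb ab).
move=> Fa; have la : src l = rng a by rewrite (boundary_idp_rng bF Fl Fa).
by split=> //; exists a; split=> //; exact: prefix_refl.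
Qed.

Lemma shiftK F l : boundary F -> F l -> extend l (shift l F) = F.
Proof.
move=> bF Fl; apply/seteqP; split=> a.
  by move=> [b [[_ Fb] _ ab]]; exact: boundary_prefix Fb.
move=> Fa; have [c Fc [[b lb cE] ac]] := boundary_directed bF Fl Fa.
by exists b; split=> //; [split=> //|]; rewrite -cE.
Qed.

Lemma shift_comp F a b : src a = rng b -> shift (comp a b) F = shift b (shift a F).
Proof.
move=> ab; apply/seteqP; split=> c.
  by move=> [+ Fc]; rewrite src_comp// => bc; split=> //; split;
     rewrite ?rng_comp ?comp_assoc.
by move=> [bc [_ Fc]]; split; rewrite ?src_comp -?comp_assoc.
Qed.

Lemma extend_comp F a b : src a = rng b ->
  extend (comp a b) F = extend a (extend b F).
Proof.
move=> ab; apply/seteqP; split=> c.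
  move=> [d [Fd + cd]]; rewrite src_comp// => bd; exists (comp b d).
  split; [|by rewrite rng_comp|by rewrite comp_assoc].
  by exists d; split=> //; exact: prefix_refl.
move=> [d [[e [Fe be de]] ad cd]]; exists e; split; rewrite ?src_comp//.
apply: (prefix_trans cd); rewrite -comp_assoc//; exact: prefix_compl.
Qed.

Lemma shift_idp_id F v : boundary F -> F (idp v) -> shift (idp v) F = F.
Proof.
move=> bF Fv; apply/seteqP; split=> a.
  by move=> []; rewrite src_idp => ->; rewrite comp_idl.
move=> Fa; have E := boundary_idp_rng bF Fv Fa.
by split; rewrite ?src_idp// -E comp_idl.
Qed.

Lemma extend_idp_id F v : boundary F -> F (idp v) -> extend (idp v) F = F.
Proof. by move=> bF Fv; rewrite -{1}(shift_idp_id bF Fv) shiftK. Qed.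

Section LocallyConvex.
Hypothesis lc : locally_convex L.

Lemma boundary_extend F l : boundary F -> F (idp (src l)) -> boundary (extend l F).
Proof.
move=> bF Fl; have [pre dir meets] := bF; split.
- by move=> a b ab [c [Fc lc' bc]]; exists c; split=> //; exact: prefix_trans bc.
- move=> a b [c [Fc lc' ac]] [d [Fd ld bd]]; have [e Fe [ce de]] := dir _ _ Fc Fd.
  have le : src l = rng e by rewrite (prefix_rng ce).
  exists (comp l e); first by exists e; split=> //; exact: prefix_refl.
  by split; [apply: (prefix_trans ac) | apply: (prefix_trans bd)];
     exact: prefix_compl.
(* The path l a meets the bound [deg l + n], and local convexity truncates it to the bound n. *)
- move=> n; have [a Fa an] := meets n.
  have la : src l = rng a by rewrite (boundary_idp_rng bF Fl Fa).
  have [|b ba bn] := @paths_le_prefix _ _ lc n _ _ _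
      (paths_le_comp la (@paths_le_deg _ _ l) an).
    by move=> i; rewrite addNkE leq_addl.
  by exists b => //; exists a.
Qed.

(** Concatenate paths that are maximal for the bound (1,...,1). The first j of them form a path x_j
    that is maximal for (j,...,j); any bound n lies below such a multiple, so local convexity
    truncates some x_j to an element maximal for n. *)
Lemma boundary_exists v : exists2 F, boundary F & F (idp v).
Proof.
have /choice[step stepP] : forall l : path L,
    exists b, src l = rng b /\ paths_le [ffun=> 1%N] b.
  by move=> l; have [b bl bn] := paths_le_exists (src l) [ffun=> 1%N]; exists b.
pose x := fix x j := if j is j'.+1 then comp (x j') (step (x j')) else idp v.
have xS j : prefix (x j) (x j.+1) by apply: prefix_comp; case: (stepP (x j)).
have x_mono i j : (i <= j)%N -> prefix (x i) (x j).
  move=> /subnKC <-; elim: (j - i)%N => [|d IH].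
    by rewrite addn0; exact: prefix_refl.
  by rewrite addnS; exact: prefix_trans (xS _).
have x_le j : paths_le [ffun=> j] (x j).
  elim: j => [|j IH].
    by split=> i; rewrite /= deg_idp zeroNkE ?ffunE.
  have -> : [ffun=> j.+1] = [ffun=> j] + [ffun=> 1%N] :> 'N^k.
    by apply/ffunP => i; rewrite addNkE !ffunE addn1.
  by apply: paths_le_comp => //; case: (stepP (x j)).
exists [set a | exists j, prefix a (x j)]; last by exists 0%N; exact: prefix_refl.
split.
- by move=> a l al [j lj]; exists j; exact: prefix_trans lj.
- move=> a b [i ai] [j bj]; exists (x (maxn i j)).
    by exists (maxn i j); exact: prefix_refl.
  by split; [apply: (prefix_trans ai) | apply: (prefix_trans bj)];
     apply: x_mono; rewrite ?leq_maxl ?leq_maxr.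
- move=> n; pose N := (\sum_i n i)%N.
  have [|a ax an] := @paths_le_prefix _ _ lc n _ _ _ (x_le N).
    by move=> i; rewrite ffunE /N (bigD1 i)//= leq_addr.
  by exists a => //; exists N.
Qed.

End LocallyConvex.
End BoundaryPaths.

(** * Kumjian-Pask families *)

Lemma fsbig_morph (V W : nmodType) (I : choiceType) (D : set I) (g : I -> V)
    (h : V -> W) : finite_set D -> h 0 = 0 -> {morph h : x y / x + y} ->
  h (\sum_(i \in D) g i) = \sum_(i \in D) h (g i).
Proof. by move=> Dfin h0 hD; rewrite !fsbig_finite//; exact: big_morph. Qed.

(** * Unbundled linear maps and non-unital algebras *)

Section LinearFor.
Variables (R : pzRingType) (U V : lmodType R) (f : U -> V).
Hypothesis flin : linear f.

Lemma linear_forD x y : f (x + y) = f x + f y.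
Proof. by have := flin 1 x y; rewrite !scale1r. Qed.

Lemma linear_for0 : f 0 = 0.
Proof. by have := flin (-1) 0 0; rewrite scaler0 addr0 scaleN1r addNr. Qed.

Lemma linear_forZ a x : f (a *: x) = a *: f x.
Proof. by have := flin a x 0; rewrite !addr0 linear_for0 addr0. Qed.

End LinearFor.

Section NuAlgebraTheory.
Variables (R : comPzRingType) (A : nualgebra R).
Implicit Types x y : A.

Lemma numul0l x : 0 ** x = 0.
Proof. by have := numulZl 0 0 x; rewrite !scale0r. Qed.

Lemma numul0r x : x ** 0 = 0.
Proof. by have := numulZr 0 x 0; rewrite !scale0r. Qed.

Lemma numul_fsbigl (I : choiceType) (D : set I) (g : I -> A) x : finite_set D ->
  (\sum_(i \in D) g i) ** x = \sum_(i \in D) (g i ** x).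
Proof.
move=> fD; apply: (@fsbig_morph _ _ _ _ _ (fun y => y ** x)) => //.
  exact: numul0l.
by move=> y z; exact: numulDl.
Qed.

Lemma numul_fsbigr (I : choiceType) (D : set I) (g : I -> A) x : finite_set D ->
  x ** (\sum_(i \in D) g i) = \sum_(i \in D) (x ** g i).
Proof.
move=> fD; apply: (@fsbig_morph _ _ _ _ _ (fun y => x ** y)) => //.
  exact: numul0r.
by move=> y z; exact: numulDr.
Qed.

End NuAlgebraTheory.

(** * The algebra of endomorphisms of a module *)

Section EndAlgebra.
Variables (R : comPzRingType) (M : lmodType R).

(** Linearity is made a predicate closed under the module operations, so that [endo] inherits its
    module structure as a submodule of the function space. *)
Definition is_linear : {pred M -> M} := fun f => `[< linear f >].

Fact is_linear_submod_closed : submod_closed is_linear.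
Proof.
split; first by apply/asboolP => a x y /=; rewrite [RHS]addr0 scaler0.
move=> a f g /asboolP flin /asboolP glin; apply/asboolP => b x y.
change (a *: f (b *: x + y) + g (b *: x + y) =
  b *: (a *: f x + g x) + (a *: f y + g y)).
by rewrite flin glin !scalerDr !scalerA (mulrC a) addrACA.
Qed.

HB.instance Definition _ := GRing.isSubmodClosed.Build _ _ is_linear
  is_linear_submod_closed.

Record endo := Endo { endo_fun :> M -> M; endo_funP : endo_fun \in is_linear }.

HB.instance Definition _ := [isSub for endo_fun].
HB.instance Definition _ := [Choice of endo by <:].
HB.instance Definition _ := [SubChoice_isSubLmodule of endo by <:].

Implicit Types f g h : endo.

Lemma endo_linear f : linear f.
Proof. exact/asboolP/endo_funP. Qed.

Lemma endoP f g : f =1 g -> f = g.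
Proof. by move=> fg; apply: val_inj; apply/funext. Qed.

Definition mk_endo (f : M -> M) (flin : linear f) : endo :=
  Endo (asboolT flin : f \in is_linear).

Fact endo_comp_linear f g : linear (f \o g).
Proof. by move=> a x y /=; rewrite !endo_linear. Qed.

Definition endo_comp f g := mk_endo (endo_comp_linear f g).

Fact endo_compA : associative endo_comp.
Proof. by move=> f g h; apply: endoP. Qed.

Fact endo_compDl : left_distributive endo_comp +%R.
Proof. by move=> f g h; apply: endoP. Qed.

Fact endo_compDr : right_distributive endo_comp +%R.
Proof. by move=> f g h; apply: endoP => x; exact: linear_forD (endo_linear f) _ _. Qed.

Fact endo_compZl a f g : endo_comp (a *: f) g = a *: endo_comp f g.
Proof. by apply: endoP. Qed.

Fact endo_compZr a f g : endo_comp f (a *: g) = a *: endo_comp f g.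
Proof. by apply: endoP => x; exact: linear_forZ (endo_linear f) _ _. Qed.

Definition endo_alg : nualgebra R :=
  NuAlgebra endo_compA endo_compDl endo_compDr endo_compZl endo_compZr.

Lemma endo_fsbigE (I : choiceType) (D : set I) (g : I -> endo_alg) x :
  finite_set D -> (\sum_(i \in D) g i : endo) x = \sum_(i \in D) (g i : endo) x.
Proof.
by move=> fD; have := @fsbig_morph endo_alg M I D g (fun f : endo => f x) fD; apply.
Qed.

End EndAlgebra.

(** * Operators induced by partial maps *)

Section WeightedComposition.
Variables (R : comPzRingType) (X : Type) (V : lmodType R).
Implicit Types (c : X -> Prop) (g : X -> X).

(** The pullback of functions along the partial map g with domain c, extended by 0. Being a
    pullback, it reverses the order of composition, as [wcompM] shows. *)
Definition wcomp_fun c g (f : X -> V) x : V := if `[< c x >] then f (g x) else 0.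

Fact wcomp_linear c g : linear (wcomp_fun c g).
Proof.
move=> a f f'; apply/funext => x; rewrite /wcomp_fun; change
  ((if `[< c x >] then a *: f (g x) + f' (g x) else 0) =
  a *: (if `[< c x >] then f (g x) else 0) + if `[< c x >] then f' (g x) else 0).
by case: ifP => // _; rewrite scaler0 addr0.
Qed.

Definition wcomp c g : endo_alg (X -> V) := mk_endo (wcomp_linear c g).

Lemma wcompM c g c' g' :
  wcomp c g ** wcomp c' g' = wcomp (fun x => c x /\ c' (g x)) (g' \o g).
Proof.
apply: endoP => f; apply/funext => x /=; rewrite /wcomp_fun /=.
by rewrite asbool_and; case: asbool.
Qed.

Lemma eq_wcomp c g c' g' : (forall x, c x <-> c' x) ->
  (forall x, c x -> g x = g' x) -> wcomp c g = wcomp c' g'.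
Proof.
move=> cc' gg'; apply: endoP => f; apply/funext => x /=; rewrite /wcomp_fun.
by rewrite -(asbool_equiv_eq (cc' x)); case: asboolP => // /gg' ->.
Qed.

Lemma wcomp0 c g : (forall x, ~ c x) -> wcomp c g = 0.
Proof.
move=> cF; apply: endoP => f; apply/funext => x /=; rewrite /wcomp_fun.
by case: asboolP => // /cF.
Qed.

End WeightedComposition.

(** * Constructing Kumjian-Pask families and calculating in them *)

Section FamilyFacts.
Variables (k : nat) (L : kgraph k) (R : comPzRingType) (A : nualgebra R).
Implicit Types (v w : vertex L) (l m a b : path L) (n : 'N^k).

Definition path_ghost_fun (E G : path L -> A) (x : path_or_ghost L) : A :=
  match x with inl e => E (val e) | inr e => G (val e) end.

Section Build.
Variables (P : vertex L -> A) (E G : path L -> A).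
Hypotheses (E_idp : forall v, E (idp v) = P v) (G_idp : forall v, G (idp v) = P v).

Lemma path_elt_fun l : path_elt P (path_ghost_fun E G) l = E l.
Proof.
rewrite /path_elt; case: insubP => [e _ <- //|/negPn/eqP dl].
by rewrite -E_idp -deg0_idp.
Qed.

Lemma ghost_elt_fun l : ghost_elt P (path_ghost_fun E G) l = G l.
Proof.
rewrite /ghost_elt; case: insubP => [e _ <- //|/negPn/eqP dl].
by rewrite -G_idp -deg0_idp.
Qed.

(** When E and G are given on all paths and agree with P on identity paths, the vertex relations of
    (KP2) are the instances of multiplicativity in which one factor is an identity path. *)
Lemma KP_family_build :
  (forall v w, P v ** P w = if v == w then P v else 0) ->
  (forall l m, src l = rng m -> E l ** E m = E (comp l m)) ->
  (forall l m, src l = rng m -> G m ** G l = G (comp l m)) ->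
  (forall n l m, n != 0 -> paths_le n l -> paths_le n m ->
    G l ** E m = if l == m then P (src l) else 0) ->
  (forall v n, n != 0 -> P v = \sum_(l \in paths_le_at v n) (E l ** G l)) ->
  KP_family P (path_ghost_fun E G).
Proof.
move=> PP EE GG GE EG; split.
- exact: PP.
- by move=> l m _ _ lm; rewrite !path_elt_fun EE.
- by move=> l m _ _ lm; rewrite !ghost_elt_fun GG.
- by move=> l _; rewrite path_elt_fun -!E_idp !EE ?src_idp ?rng_idp ?comp_idl ?comp_idr.
- by move=> l _; rewrite ghost_elt_fun -!G_idp !GG ?src_idp ?rng_idp ?comp_idl ?comp_idr.
- by move=> n l m n0 ln mn; rewrite ghost_elt_fun path_elt_fun; exact: GE ln mn.
- move=> v n n0; rewrite (EG _ _ n0); apply: eq_fsbigr => l _.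
  by rewrite ghost_elt_fun path_elt_fun.
Qed.

End Build.

Section Facts.
Variables (P : vertex L -> A) (S : path_or_ghost L -> A).
Hypothesis fam : KP_family P S.
Local Notation E := (path_elt P S).
Local Notation G := (ghost_elt P S).

Lemma path_elt_deg0 l : deg l = 0 -> E l = P (rng l).
Proof. by move=> dl; rewrite /path_elt; case: insubP => // e; rewrite dl eqxx. Qed.

Lemma ghost_elt_deg0 l : deg l = 0 -> G l = P (rng l).
Proof. by move=> dl; rewrite /ghost_elt; case: insubP => // e; rewrite dl eqxx. Qed.

Lemma path_elt_idp v : E (idp v) = P v.
Proof. by rewrite path_elt_deg0 ?rng_idp ?deg_idp. Qed.

Lemma ghost_elt_idp v : G (idp v) = P v.
Proof. by rewrite ghost_elt_deg0 ?rng_idp ?deg_idp. Qed.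

Lemma vertex_idem v : P v ** P v = P v.
Proof. by rewrite (KP1 fam) eqxx. Qed.

Lemma rng_path_elt l : P (rng l) ** E l = E l.
Proof.
have [/path_elt_deg0 ->|/(KP2_path_vertex fam)[]//] := eqVneq (deg l) 0.
exact: vertex_idem.
Qed.

Lemma path_elt_src l : E l ** P (src l) = E l.
Proof.
have [dl|/(KP2_path_vertex fam)[]//] := eqVneq (deg l) 0.
by rewrite (deg0_idp dl) path_elt_idp src_idp vertex_idem.
Qed.

Lemma src_ghost_elt l : P (src l) ** G l = G l.
Proof.
have [dl|/(KP2_ghost_vertex fam)[]//] := eqVneq (deg l) 0.
by rewrite (deg0_idp dl) ghost_elt_idp src_idp vertex_idem.
Qed.

Lemma ghost_elt_rng l : G l ** P (rng l) = G l.
Proof.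
have [/ghost_elt_deg0 ->|/(KP2_ghost_vertex fam)[]//] := eqVneq (deg l) 0.
exact: vertex_idem.
Qed.

Lemma path_eltM l m : src l = rng m -> E l ** E m = E (comp l m).
Proof.
move=> lm; have [dl|dl] := eqVneq (deg l) 0.
  rewrite (path_elt_deg0 dl) {2}(deg0_idp dl).
  have -> : rng l = rng m by rewrite -lm (deg0_idp dl) src_idp rng_idp.
  by rewrite comp_idl rng_path_elt.
have [dm|dm] := eqVneq (deg m) 0; last exact: (KP2_path fam).
by rewrite (path_elt_deg0 dm) (deg0_idp dm) rng_idp -lm comp_idr path_elt_src.
Qed.

Lemma ghost_eltM l m : src l = rng m -> G m ** G l = G (comp l m).
Proof.
move=> lm; have [dl|dl] := eqVneq (deg l) 0.
  rewrite (ghost_elt_deg0 dl) {2}(deg0_idp dl).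
  have -> : rng l = rng m by rewrite -lm (deg0_idp dl) src_idp rng_idp.
  by rewrite comp_idl ghost_elt_rng.
have [dm|dm] := eqVneq (deg m) 0; last exact: (KP2_ghost fam).
by rewrite (ghost_elt_deg0 dm) (deg0_idp dm) rng_idp -lm comp_idr src_ghost_elt.
Qed.

(** The idempotents of the two sources can be inserted between the factors, and they are orthogonal
    by (KP1). *)
Lemma path_ghost_eq0 a b : src a != src b -> E a ** G b = 0.
Proof.
move=> ab; rewrite -path_elt_src -src_ghost_elt numulA -(numulA (E a)).
by rewrite (KP1 fam) (negPf ab) numul0r numul0l.
Qed.

End Facts.
End FamilyFacts.

(** * The representation on functions of boundary paths *)

Section BoundaryRepresentation.
Variables (k : nat) (L : kgraph k) (R : comPzRingType).
Hypotheses (lc : locally_convex L) (rf : row_finite L).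
Let bd_alg : nualgebra R := endo_alg (set (path L) -> R^o).

(** The functions are defined on all sets of paths, and being a boundary path is part of each
    operator's domain. Because operators are pullbacks, a path acts through [shift] and its ghost
    through [extend]; thus [bd_path l] carries the indicator of a boundary path x with range [src l]
    to that of l x. *)
Definition bd_vertex (v : vertex L) : bd_alg :=
  wcomp _ (fun F => boundary F /\ F (idp v)) id.
Definition bd_path (l : path L) : bd_alg :=
  wcomp _ (fun F => boundary F /\ F l) (shift l).
Definition bd_ghost (l : path L) : bd_alg :=
  wcomp _ (fun F => boundary F /\ F (idp (src l))) (extend l).

Lemma bd_family : KP_family bd_vertex (path_ghost_fun bd_path bd_ghost).
Proof.
apply: KP_family_build.
- by move=> v; apply: eq_wcomp => // F [bF Fv]; rewrite shift_idp_id.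
- by move=> v; apply: eq_wcomp => [F|F [bF]]; rewrite src_idp // => Fv;
     rewrite extend_idp_id.
- move=> v w; rewrite wcompM; case: eqVneq => [<-|vw].
    by apply: eq_wcomp => // F; split=> [[]//|bF].
  apply: wcomp0 => F /= [[bF Fv] [_ Fw]]; move: vw.
  by rewrite -(boundary_idp_rng bF Fv Fw) rng_idp eqxx.
- move=> l m lm; rewrite wcompM; apply: eq_wcomp => F; last first.
    by move=> _; rewrite shift_comp.
  split=> [[[bF _] [_ [_ Flm]]]//|[bF Flm]].
  have Fl : F l by apply: (boundary_prefix bF) Flm; exact: prefix_comp.
  by split=> //; split=> //; exact: boundary_shift.
- move=> l m lm; rewrite wcompM; apply: eq_wcomp => F; last first.
    by move=> _; rewrite extend_comp.
  rewrite src_comp//; split=> [[]//|[bF Fm]]; split=> //.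
  split; first exact: boundary_extend.
  rewrite lm; apply: boundary_idp; first exact: boundary_extend.
  exact: extend_self.
- move=> n l m _ ln mn; rewrite wcompM; case: eqVneq => [<-|lm].
    apply: eq_wcomp => F; last by move=> [[bF Fl] _]; rewrite /= extendK.
    split=> [[]//|[bF Fl]]; split=> //; split; first exact: boundary_extend.
    exact: extend_self.
  apply: wcomp0 => F [[bF Fl] [beF Fm]]; move/eqP: lm; apply.
  exact: (boundary_uniq beF (extend_self Fl) Fm ln mn).
- move=> v n n0; have fin := paths_le_at_finite v n rf.
  apply: endoP => f; apply/funext => F.
  rewrite endo_fsbigE// (@fsbig_morph _ _ _ _ _ (fun f : _ -> R^o => f F))//=.
  (* Each summand multiplies by the indicator of the boundary paths through l. A boundary path with
     range v contains exactly one l of the index set, so exactly one term survives; any other F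
     kills every term. *)
  transitivity (\sum_(l \in paths_le_at v n)
    if `[< boundary F /\ F l >] then f F else 0 : R^o).
    rewrite /wcomp_fun; case: asboolP => [[bF Fv]|nF].
      have [a Fa an] := boundary_meets_at n bF Fv.
      rewrite (fsbigD1 a)//= fsbig1 ?addr0 ?asboolT// => b [bn ba].
      rewrite asboolF// => -[_ Fb]; apply: ba.
      exact: (boundary_uniq bF Fb Fa bn.2 an.2).
    rewrite fsbig1// => l [/= lv _]; rewrite asboolF// => -[bF Fl]; apply: nF.
    by split=> //; rewrite -lv; exact: boundary_idp.
  apply: eq_fsbigr => l _; rewrite /wcomp_fun; case: asboolP => // -[bF Fl].
  rewrite asboolT ?shiftK//; split; first exact: boundary_shift.
  exact: shift_idp.
Qed.

(** Applied to the constant function 1 and evaluated at a boundary path with range v, the operator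
    gives r. *)
Lemma bd_vertex_neq0 (r : R) v : r != 0 -> r *: bd_vertex v != 0.
Proof.
move=> r0; apply/eqP => E; have [F bF Fv] := boundary_exists lc v.
have := congr1 (fun g : endo (set (path L) -> R^o) => g (fun=> 1) F) E.
change (r *: @wcomp_fun R _ R^o (fun F => boundary F /\ F (idp v)) id (fun=> 1) F
  = 0 -> False).
by rewrite /wcomp_fun asboolT// [LHS]mulr1 => /eqP; rewrite (negPf r0).
Qed.

End BoundaryRepresentation.

(** * The universal algebra *)

Section UniversalAlgebra.
Local Open Scope quotient_scope.
Variables (k : nat) (L : kgraph k) (R : comPzRingType).

Inductive term : Type :=
| Tvertex of vertex L
| Tpath of path_or_ghost L
| Tzero
| Tadd of term & term
| Tmul of term & term
| Tscale of R & term.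

HB.instance Definition _ := gen_eqMixin term.
HB.instance Definition _ := gen_choiceMixin term.

Implicit Types t u : term.

Fixpoint eval (A : nualgebra R) (P : vertex L -> A) (S : path_or_ghost L -> A) t :=
  match t with
  | Tvertex v => P v
  | Tpath x => S x
  | Tzero => 0
  | Tadd t u => eval P S t + eval P S u
  | Tmul t u => eval P S t ** eval P S u
  | Tscale a t => a *: eval P S t
  end.

(** Agreement in every family is automatically a congruence for the term operations, so no ideal of
    relations has to be generated. *)
Definition same_value t u : Prop :=
  forall (A : nualgebra R) (P : vertex L -> A) (S : path_or_ghost L -> A),
    KP_family P S -> eval P S t = eval P S u.

Definition teq t u := `[< same_value t u >].

Fact teq_refl : reflexive teq.
Proof. by move=> t; apply/asboolP => A P S _. Qed.

Fact teq_sym : symmetric teq.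
Proof.
by move=> t u; apply/asboolP/asboolP => tu A P S fam; rewrite (tu A P S).
Qed.

Fact teq_trans : transitive teq.
Proof.
move=> u t w /asboolP tu /asboolP uw; apply/asboolP => A P S fam.
by rewrite (tu A P S)// (uw A P S).
Qed.

Canonical teq_equiv := EquivRel teq teq_refl teq_sym teq_trans.

Definition kp_car := {eq_quot teq_equiv}.
HB.instance Definition _ := Choice.on kp_car.
HB.instance Definition _ := EqQuotient.on kp_car.

Implicit Types x y z : kp_car.

Definition kp_class t : kp_car := \pi_kp_car t.

Definition kp_eval (A : nualgebra R) (P : vertex L -> A)
    (S : path_or_ghost L -> A) (x : kp_car) := eval P S (repr x).

Lemma kp_eval_class (A : nualgebra R) P S t : KP_family P S ->
  @kp_eval A P S (kp_class t) = eval P S t.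
Proof.
have /eqmodP/asboolP same : repr (kp_class t) = t %[mod kp_car] by rewrite reprK.
exact: same.
Qed.

Lemma kp_classP x : exists t, x = kp_class t.
Proof. by exists (repr x); rewrite /kp_class reprK. Qed.

(** Evaluations separate the points of the quotient. Every algebra law below thereby reduces to the
    same law in an arbitrary target algebra. *)
Lemma kp_ext x y : (forall (A : nualgebra R) P S, KP_family P S ->
  @kp_eval A P S x = kp_eval P S y) -> x = y.
Proof. by move=> xy; rewrite -[x]reprK -[y]reprK; apply/eqmodP/asboolP. Qed.

Definition kp_add x y := kp_class (Tadd (repr x) (repr y)).
Definition kp_mul x y := kp_class (Tmul (repr x) (repr y)).
Definition kp_scale a x := kp_class (Tscale a (repr x)).
Definition kp_zero := kp_class Tzero.
Definition kp_opp x := kp_scale (-1) x.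

Section Evaluation.
Variables (A : nualgebra R) (P : vertex L -> A) (S : path_or_ghost L -> A).
Hypothesis fam : KP_family P S.
Local Notation ev := (kp_eval P S).

Lemma kp_evalD x y : ev (kp_add x y) = ev x + ev y.
Proof. by rewrite kp_eval_class. Qed.

Lemma kp_evalM x y : ev (kp_mul x y) = ev x ** ev y.
Proof. by rewrite kp_eval_class. Qed.

Lemma kp_evalZ a x : ev (kp_scale a x) = a *: ev x.
Proof. by rewrite kp_eval_class. Qed.

Lemma kp_eval0 : ev kp_zero = 0.
Proof. by rewrite kp_eval_class. Qed.

Lemma kp_evalN x : ev (kp_opp x) = - ev x.
Proof. by rewrite kp_evalZ scaleN1r. Qed.

End Evaluation.

Let evE := (kp_evalD, kp_evalM, kp_evalZ, kp_eval0, kp_evalN).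

Fact kp_addA : associative kp_add.
Proof. by move=> x y z; apply: kp_ext => A P S fam; rewrite !evE// addrA. Qed.

Fact kp_addC : commutative kp_add.
Proof. by move=> x y; apply: kp_ext => A P S fam; rewrite !evE// addrC. Qed.

Fact kp_add0 : left_id kp_zero kp_add.
Proof. by move=> x; apply: kp_ext => A P S fam; rewrite !evE// add0r. Qed.

Fact kp_addN : left_inverse kp_zero kp_opp kp_add.
Proof. by move=> x; apply: kp_ext => A P S fam; rewrite !evE// addNr. Qed.

HB.instance Definition _ :=
  GRing.isZmodule.Build kp_car kp_addA kp_addC kp_add0 kp_addN.

Fact kp_scaleA a b x : kp_scale a (kp_scale b x) = kp_scale (a * b) x.
Proof. by apply: kp_ext => A P S fam; rewrite !evE// scalerA. Qed.

Fact kp_scale1 : left_id 1 kp_scale.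
Proof. by move=> x; apply: kp_ext => A P S fam; rewrite !evE// scale1r. Qed.

Fact kp_scaleDr : right_distributive kp_scale +%R.
Proof. by move=> a x y; apply: kp_ext => A P S fam; rewrite !evE// scalerDr. Qed.

Fact kp_scaleDl x : {morph kp_scale^~ x : a b / a + b}.
Proof. by move=> a b; apply: kp_ext => A P S fam; rewrite !evE// scalerDl. Qed.

HB.instance Definition _ := GRing.Zmodule_isLmodule.Build R kp_car
  kp_scaleA kp_scale1 kp_scaleDr kp_scaleDl.

Fact kp_mulA : associative kp_mul.
Proof. by move=> x y z; apply: kp_ext => A P S fam; rewrite !evE// numulA. Qed.

Fact kp_mulDl : left_distributive kp_mul +%R.
Proof. by move=> x y z; apply: kp_ext => A P S fam; rewrite !evE// numulDl. Qed.

Fact kp_mulDr : right_distributive kp_mul +%R.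
Proof. by move=> x y z; apply: kp_ext => A P S fam; rewrite !evE// numulDr. Qed.

Fact kp_mulZl a x y : kp_mul (a *: x) y = a *: kp_mul x y.
Proof. by apply: kp_ext => A P S fam; rewrite !evE// numulZl. Qed.

Fact kp_mulZr a x y : kp_mul x (a *: y) = a *: kp_mul x y.
Proof. by apply: kp_ext => A P S fam; rewrite !evE// numulZr. Qed.

Definition kp_alg : nualgebra R :=
  NuAlgebra kp_mulA kp_mulDl kp_mulDr kp_mulZl kp_mulZr.

Definition kp_vertex v : kp_alg := kp_class (Tvertex v).
Definition kp_gen (x : path_or_ghost L) : kp_alg := kp_class (Tpath x).

Lemma kp_eval_alg_hom (A : nualgebra R) P S : KP_family P S ->
  alg_hom (@kp_eval A P S : kp_alg -> A).
Proof.
move=> fam; split; first by move=> a x y; rewrite !evE.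
by move=> x y; rewrite !evE.
Qed.

Lemma path_elt_map (A B : nualgebra R) (h : A -> B) P S l :
  h (@path_elt k L R A P S l) = path_elt (h \o P) (h \o S) l.
Proof. by rewrite /path_elt; case: insub. Qed.

Lemma ghost_elt_map (A B : nualgebra R) (h : A -> B) P S l :
  h (@ghost_elt k L R A P S l) = ghost_elt (h \o P) (h \o S) l.
Proof. by rewrite /ghost_elt; case: insub. Qed.

Section Evaluation.
Variables (A : nualgebra R) (P : vertex L -> A) (S : path_or_ghost L -> A).
Hypothesis fam : KP_family P S.

Lemma kp_eval_vertex : kp_eval P S \o kp_vertex = P.
Proof. by apply/funext => v; rewrite /= kp_eval_class. Qed.

Lemma kp_eval_gen : kp_eval P S \o kp_gen = S.
Proof. by apply/funext => v; rewrite /= kp_eval_class. Qed.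

Lemma kp_eval_path l : kp_eval P S (path_elt kp_vertex kp_gen l) = path_elt P S l.
Proof.
by rewrite (path_elt_map (kp_eval P S : kp_alg -> A)) kp_eval_vertex kp_eval_gen.
Qed.

Lemma kp_eval_ghost l : kp_eval P S (ghost_elt kp_vertex kp_gen l) = ghost_elt P S l.
Proof.
by rewrite (ghost_elt_map (kp_eval P S : kp_alg -> A)) kp_eval_vertex kp_eval_gen.
Qed.

Lemma kp_eval_numul (x y : kp_alg) :
  kp_eval P S (x ** y) = kp_eval P S x ** kp_eval P S y.
Proof. exact: kp_evalM. Qed.

End Evaluation.

(** Each relation holds because it holds under every evaluation. In (KP4') row-finiteness makes the
    sum finite, so that evaluation commutes with it. *)
Lemma kp_family : row_finite L -> KP_family kp_vertex kp_gen.
Proof.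
move=> rf; have ev_vertex A P S (fam : KP_family P S) v :
    @kp_eval A P S (kp_vertex v) = P v by rewrite kp_eval_class.
have evM := (kp_eval_numul, kp_eval_path, kp_eval_ghost, ev_vertex).
split.
- move=> v w; apply: kp_ext => A P S fam; rewrite !evM// (KP1 fam).
  by case: ifP => _; rewrite ?ev_vertex ?kp_eval0.
- move=> l m dl dm lm; apply: kp_ext => A P S fam; rewrite !evM//.
  exact: KP2_path fam _ _ dl dm lm.
- move=> l m dl dm lm; apply: kp_ext => A P S fam; rewrite !evM//.
  exact: KP2_ghost fam _ _ dl dm lm.
- move=> l dl; split; apply: kp_ext => A P S fam; rewrite !evM//.
    exact: (KP2_path_vertex fam dl).1.
  exact: (KP2_path_vertex fam dl).2.
- move=> l dl; split; apply: kp_ext => A P S fam; rewrite !evM//.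
    exact: (KP2_ghost_vertex fam dl).1.
  exact: (KP2_ghost_vertex fam dl).2.
- move=> n l m n0 ln mn; apply: kp_ext => A P S fam; rewrite !evM//.
  rewrite (KP3' fam n0 ln mn); case: ifP => _; by rewrite ?ev_vertex ?kp_eval0.
- move=> v n n0; apply: kp_ext => A P S fam; rewrite ev_vertex//.
  rewrite (KP4' fam v n0) (@fsbig_morph kp_alg A _ _ _ (kp_eval P S)).
  + by apply: eq_fsbigr => l _; rewrite !evM.
  + exact: paths_le_at_finite.
  + exact: kp_eval0.
  + exact: kp_evalD.
Qed.

Lemma kp_generates : generates (range kp_vertex `|` range kp_gen).
Proof.
move=> U [[U0 UD UZ] UM] gen; apply/seteqP; split=> // x _.
have [t ->] := kp_classP x; elim: t => [v|y||t IHt u IHu|t IHt u IHu|a t IHt].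
- by apply: gen; left; exists v.
- by apply: gen; right; exists y.
- exact: U0.
- suff -> : kp_class (Tadd t u) = kp_class t + kp_class u by exact: UD.
  by apply: kp_ext => A P S fam; rewrite kp_evalD// !kp_eval_class.
- suff -> : kp_class (Tmul t u) = (kp_class t : kp_alg) ** kp_class u by exact: UM.
  by apply: kp_ext => A P S fam; rewrite kp_evalM// !kp_eval_class.
- suff -> : kp_class (Tscale a t) = a *: kp_class t by exact: UZ.
  by apply: kp_ext => A P S fam; rewrite kp_evalZ// !kp_eval_class.
Qed.

End UniversalAlgebra.

Section Generation.
Variables (R : comPzRingType) (A B : nualgebra R).

(** The elements on which f and g agree form a subalgebra containing X. *)
Lemma alg_hom_eq_gen (X : set A) (f g : A -> B) : generates X ->
  alg_hom f -> alg_hom g -> (forall x, X x -> f x = g x) -> f = g.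
Proof.
move=> gen [fL fM] [gL gM] fg.
suff U : [set x | f x = g x] = setT.
  by apply/funext => x; have : [set x | f x = g x] x by rewrite U.
apply: gen => //; split; [split|] => /=.
- by rewrite !linear_for0.
- by move=> x y; rewrite !linear_forD// => -> ->.
- by move=> a x; rewrite !linear_forZ// => ->.
- by move=> x y; rewrite fM gM => -> ->.
Qed.

End Generation.

Lemma kp_universal (k : nat) (L : kgraph k) (R : comPzRingType) :
  KP_universal (@kp_vertex k L R) (@kp_gen k L R).
Proof.
move=> A Q T fam; exists (kp_eval Q T : kp_alg L R -> A); split.
  by split; [exact: kp_eval_alg_hom | exact: kp_eval_vertex | exact: kp_eval_gen].
move=> f [fhom fQ fT]; apply: (alg_hom_eq_gen (@kp_generates k L R)) => //.
  exact: kp_eval_alg_hom.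
move=> x [[v _ <-]|[y _ <-]].
  exact: etrans (congr1 (@^~ v) (kp_eval_vertex fam)) (esym (congr1 (@^~ v) fQ)).
exact: etrans (congr1 (@^~ y) (kp_eval_gen fam)) (esym (congr1 (@^~ y) fT)).
Qed.

Lemma KP_vertex_neq0 (k : nat) (L : kgraph k) (R : comPzRingType)
    (K : nualgebra R) (p : vertex L -> K) (s : path_or_ghost L -> K) r v :
  locally_convex L -> row_finite L -> KP_universal p s ->
  r != 0 -> r *: p v != 0.
Proof.
move=> lc rf univ r0; have [h [[[hlin _] hp _] _]] := univ _ _ _ (bd_family R lc rf).
apply: contra_neq (bd_vertex_neq0 lc v r0) => rpv.
by rewrite -hp /= -(linear_forZ hlin) rpv (linear_for0 hlin).
Qed.

(** * The grading *)

Section Submodules.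
Variables (R : comPzRingType) (A : nualgebra R).
Implicit Types (X U : set A).

Lemma submodule_fsbig U (I : choiceType) (D : set I) (g : I -> A) :
  submodule U -> finite_set D -> (forall i, D i -> U (g i)) ->
  U (\sum_(i \in D) g i).
Proof.
move=> [U0 UD _] fD Ug; rewrite fsbig_finite// big_seq.
by apply: big_ind => // i; rewrite in_fset_set// inE => /Ug.
Qed.

Lemma lspan_sub X : X `<=` lspan X.
Proof.
move=> x Xx; exists 1%N, (fun=> 1), (fun=> x); split=> //.
by rewrite big_ord1 scale1r.
Qed.

Lemma lspan_submodule X : submodule (lspan X).
Proof.
split.
- by exists 0%N, (fun=> 0), (fun=> 0); rewrite big_ord0; split=> // -[].
- move=> x y [n [c [g [Xg ->]]]] [m [d [h [Xh ->]]]].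
  exists (n + m)%N, (fun i => match fintype.split i with inl j => c j | inr j => d j end),
    (fun i => match fintype.split i with inl j => g j | inr j => h j end).
  split; first by move=> i; case: (fintype.split i).
  rewrite big_split_ord /=; congr (_ + _); apply: eq_bigr => i _.
    by rewrite (unsplitK (inl i)).
  by rewrite (unsplitK (inr i)).
- move=> a x [n [c [g [Xg ->]]]]; exists n, (fun i => a * c i), g; split=> //.
  by rewrite scaler_sumr; apply: eq_bigr => i _; rewrite scalerA.
Qed.

Lemma lspan_min X U : submodule U -> X `<=` U -> lspan X `<=` U.
Proof.
move=> [U0 UD UZ] XU x [n [c [g [Xg ->]]]].
by apply: big_ind => // i _; apply: UZ; exact: XU.
Qed.

(** For a fixed left factor the admissible right factors form a submodule, and symmetrically, so
    [lspan_min] applies in each variable in turn. *)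
Lemma lspan_mul X Y U : submodule U ->
  (forall x y, X x -> Y y -> U (x ** y)) ->
  forall x y, lspan X x -> lspan Y y -> U (x ** y).
Proof.
move=> [U0 UD UZ] XYU x y Xx; move: y; apply: lspan_min.
  split=> [|y z /= Uy Uz|a y /= Uy]; rewrite /= ?numul0r//.
    by rewrite numulDr; exact: UD.
  by rewrite numulZr; exact: UZ.
move=> y Yy /=; move: x Xx; apply: lspan_min; last by move=> x Xx; exact: XYU.
split=> [|x z /= Ux Uz|a x /= Ux]; rewrite /= ?numul0l//.
  by rewrite numulDl; exact: UD.
by rewrite numulZl; exact: UZ.
Qed.

End Submodules.

Section Degrees.
Variable k : nat.
Implicit Types (m n : 'N^k) (p q : 'Z^k).

Lemma addZkE p q i : (p + q) i = p i + q i.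
Proof. by rewrite ffunE. Qed.

Lemma diffNkD m n m' n' : diffNk (m + m') (n + n') = diffNk m n + diffNk m' n'.
Proof. by apply/ffunP => i; rewrite addZkE ![diffNk _ _ _]ffunE !addNkE; lia. Qed.

(** Added to a degree, it gives the nonzero bound that (KP3') and (KP4') require. *)
Definition all_ones : 'N^k := [ffun=> 1%N].

Lemma add_all_ones_neq0 n : (0 < k)%N -> n + all_ones != 0.
Proof.
move=> k_gt0; apply/eqP => /ffunP/(_ (Ordinal k_gt0)).
by rewrite addNkE zeroNkE ffunE addn1.
Qed.

End Degrees.

(** * Products of monomials *)

Section SpanMultiplication.
Variables (k : nat) (L : kgraph k) (R : comPzRingType) (A : nualgebra R).
Hypotheses (k_gt0 : (0 < k)%N) (rf : row_finite L).
Variables (P : vertex L -> A) (S : path_or_ghost L -> A).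
Hypothesis fam : KP_family P S.
Local Notation E := (path_elt P S).
Local Notation G := (ghost_elt P S).
Implicit Types (a b c d l m : path L) (n : 'N^k).

(* Both [b l] and [c m] lie in [paths_le (deg b + deg c + all_ones k)], so that (KP3')
   applies to them. *)
Lemma ghost_pathM b c :
  G b ** E c = \sum_(l \in paths_le_at (src b) (deg c + all_ones k))
    \sum_(m \in paths_le_at (src c) (deg b + all_ones k))
      if comp b l == comp c m then E l ** G m else 0.
Proof.
(* The idempotents of the two sources are placed on the outside and expanded by (KP4'). Their inner
   factors extend b to b l and c to c m, while [E l] and [G m] stay outside. *)
rewrite -(src_ghost_elt fam b) -(path_elt_src fam c).
rewrite (KP4' fam (src b) (add_all_ones_neq0 (deg c) k_gt0)).
rewrite (KP4' fam (src c) (add_all_ones_neq0 (deg b) k_gt0)).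
rewrite !numul_fsbigl; try exact: paths_le_at_finite.
apply: eq_fsbigr => l; rewrite inE => -[/= lb ln].
rewrite !numul_fsbigr; try exact: paths_le_at_finite.
apply: eq_fsbigr => m; rewrite inE => -[/= mc mn].
rewrite -(numulA (E l)) (numulA (E c)) (ghost_eltM fam)// (path_eltM fam)//.
rewrite -(numulA (E l)) (numulA (G _)).
have bl_le : paths_le (deg b + (deg c + all_ones k)) (comp b l).
  exact: paths_le_comp (@paths_le_deg _ _ b) ln.
have cm_le : paths_le (deg b + (deg c + all_ones k)) (comp c m).
  rewrite addrCA; exact: paths_le_comp (@paths_le_deg _ _ c) mn.
rewrite (KP3' fam _ bl_le cm_le); last by rewrite addrA add_all_ones_neq0.
case: ifP => _; last by rewrite numul0l numul0r.
by rewrite src_comp// numulA (path_elt_src fam).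
Qed.

(** Degrees range over a set D so that a singleton gives the spanning set of a [KP_component] and
    [setT] gives all monomials. *)
Definition monomials (D : set 'Z^k) : set A :=
  [set x | exists a b, D (diffNk (deg a) (deg b)) /\ x = E a ** G b].

(** The product is a sum of terms [E (comp a l) ** G (comp d m)] with b l = c m. That equation
    balances the degrees of l and m against those of b and c, so every term has degree p + q. *)
Lemma monomialsM p q x y : monomials [set p] x -> monomials [set q] y ->
  lspan (monomials [set p + q]) (x ** y).
Proof.
move=> [a [b [<- ->]]] [c [d [<- ->]]] {x y p q}; set U := lspan _.
have Usub : submodule U by exact: lspan_submodule.
have [ab|/(path_ghost_eq0 fam) ->] := eqVneq (src a) (src b); last first.
  by rewrite numul0l; case: Usub.
have [cd|/(path_ghost_eq0 fam) ->] := eqVneq (src c) (src d); last first.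
  by rewrite numul0r; case: Usub.
rewrite -(numulA (E a)) (numulA (G b)) ghost_pathM.
rewrite numul_fsbigl ?numul_fsbigr; try exact: paths_le_at_finite.
apply: submodule_fsbig => //; first exact: paths_le_at_finite.
move=> l [/= lb _]; rewrite numul_fsbigl ?numul_fsbigr; try exact: paths_le_at_finite.
apply: submodule_fsbig => //; first exact: paths_le_at_finite.
move=> m [/= mc _]; case: eqP => [bcE|_]; last first.
  by rewrite numul0l numul0r; case: Usub.
rewrite -(numulA (E l)) numulA (path_eltM fam) ?ab// (ghost_eltM fam) -?cd//.
apply: lspan_sub; exists (comp a l), (comp d m); split=> //=.
rewrite !deg_comp ?ab -?cd//; apply/ffunP => i.
rewrite addZkE ![diffNk _ _ _]ffunE !addNkE.
have := congr1 (fun x => deg x i) bcE; rewrite !deg_comp// !addNkE; lia.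
Qed.

Lemma KP_componentM p q x y : KP_component P S p x -> KP_component P S q y ->
  KP_component P S (p + q) (x ** y).
Proof. by apply: lspan_mul; [exact: lspan_submodule | exact: monomialsM]. Qed.

(** The span is a subalgebra by [monomialsM]. It contains the generators, since each of them is a
    monomial once a vertex idempotent is supplied as the missing factor. *)
Lemma lspan_monomials : generates (range P `|` range S) ->
  lspan (monomials setT) = setT.
Proof.
move=> gen; have Usub := lspan_submodule (monomials setT).
have mono a b : lspan (monomials setT) (E a ** G b).
  by apply: lspan_sub; exists a, b.
apply: gen; first split=> //.
  apply: lspan_mul => // _ _ [a [b [_ ->]]] [c [d [_ ->]]].
  have : lspan (monomials [set diffNk (deg a) (deg b) + diffNk (deg c) (deg d)])
      ((E a ** G b) ** (E c ** G d)).
    by apply: monomialsM; [exists a, b | exists c, d].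
  apply: lspan_min => //; move=> _ [a' [b' [_ ->]]]; exact: mono.
move=> x [[v _ <-]|[[e|e] _ <-]].
- by rewrite -(vertex_idem fam) -{1}(path_elt_idp P S v) -(ghost_elt_idp P S v).
- have -> : S (inl e) = E (val e) by rewrite /path_elt valK.
  by rewrite -(path_elt_src fam) -(ghost_elt_idp P S).
- have -> : S (inr e) = G (val e) by rewrite /ghost_elt valK.
  by rewrite -(src_ghost_elt fam) -(path_elt_idp P S).
Qed.

End SpanMultiplication.

(* Left multiplication by a homogeneous element of degree n on functions from
   Z^k to the unitization [R^o * A], combined with the shift by n.  Twisting a
   Kumjian-Pask family in this way separates the degrees, and the unit makes
   the operator determine the element. *)
Section GradedTwist.
Variables (k : nat) (R : comPzRingType) (A : nualgebra R).
Implicit Types (x y : A) (n m : 'Z^k).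

Let M : lmodType R := 'Z^k -> (R^o * A)%type.

Definition twist_fun x n (f : M) : M :=
  fun m => (0, (f (m - n)).1 *: x + x ** (f (m - n)).2).

Fact twist_linear x n : linear (twist_fun x n).
Proof.
move=> a f g; apply/funext => m.
change (((0 : R^o), (a * (f (m - n)).1 + (g (m - n)).1) *: x +
     x ** (a *: (f (m - n)).2 + (g (m - n)).2)) =
  (a *: (0 : R^o) + 0, a *: ((f (m - n)).1 *: x + x ** (f (m - n)).2) +
     ((g (m - n)).1 *: x + x ** (g (m - n)).2))).
congr (_, _); first by rewrite scaler0 addr0.
by rewrite scalerDl scalerDr numulDr numulZr scalerA addrACA.
Qed.

Definition twist x n : endo_alg M := mk_endo (@twist_linear x n).

Lemma twistM x y m n : twist x m ** twist y n = twist (x ** y) (m + n).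
Proof.
apply: endoP => f; apply/funext => p; rewrite /= /twist_fun /=; congr (_, _).
by rewrite scale0r add0r numulDr numulZr numulA opprD addrA.
Qed.

Lemma twistD n : {morph twist^~ n : x y / x + y}.
Proof.
move=> x y; apply: endoP => f; apply/funext => p.
change (((0 : R^o), (f (p - n)).1 *: (x + y) + (x + y) ** (f (p - n)).2) =
  ((0 : R^o) + 0, ((f (p - n)).1 *: x + x ** (f (p - n)).2) +
     ((f (p - n)).1 *: y + y ** (f (p - n)).2))).
congr (_, _); first by rewrite addr0.
by rewrite scalerDr numulDl addrACA.
Qed.

Lemma twist0 n : twist 0 n = 0.
Proof.
by apply/eqP; have /eqP := twistD n 0 0; rewrite addr0 -subr_eq0 opprD addrA subrr
  sub0r oppr_eq0.
Qed.

Lemma twistZ a x n : twist (a *: x) n = a *: twist x n.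
Proof.
apply: endoP => f; apply/funext => p.
change (((0 : R^o), (f (p - n)).1 *: (a *: x) + (a *: x) ** (f (p - n)).2) =
  (a *: (0 : R^o), a *: ((f (p - n)).1 *: x + x ** (f (p - n)).2))).
congr (_, _); first by rewrite scaler0.
by rewrite scalerDr numulZl !scalerA mulrC.
Qed.

(** The test function is the unit of the unitization placed in degree 0; its image under [twist x n]
    is x in degree n and 0 elsewhere. *)
Definition coefficient (f : endo_alg M) n : A :=
  ((f : endo M) (fun m => if m == 0 then (1, 0) else 0) n).2.

Lemma coefficient_twist x n m :
  coefficient (twist x n) m = if m == n then x else 0.
Proof.
rewrite /coefficient /= /twist_fun subr_eq0.
case: ifP => _ /=; first by rewrite scale1r numul0r addr0.
by rewrite scale0r numul0r addr0.
Qed.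

Variable L : kgraph k.
Hypothesis rf : row_finite L.
Variables (P : vertex L -> A) (S : path_or_ghost L -> A).
Hypothesis fam : KP_family P S.
Local Notation E := (path_elt P S).
Local Notation G := (ghost_elt P S).

Definition twist_vertex v := twist (P v) 0.
Definition twist_path l := twist (E l) (diffNk (deg l) 0).
Definition twist_ghost l := twist (G l) (diffNk 0 (deg l)).

Lemma diffNk_id (d : 'N^k) : diffNk d d = 0.
Proof. by apply/ffunP => i; rewrite !ffunE subrr. Qed.

Lemma twist_path_idp v : twist_path (idp v) = twist_vertex v.
Proof. by rewrite /twist_path deg_idp diffNk_id path_elt_idp. Qed.

Lemma twist_ghost_idp v : twist_ghost (idp v) = twist_vertex v.
Proof. by rewrite /twist_ghost deg_idp diffNk_id ghost_elt_idp. Qed.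

Lemma twist_path_ghost a b :
  twist_path a ** twist_ghost b = twist (E a ** G b) (diffNk (deg a) (deg b)).
Proof. by rewrite twistM -diffNkD addr0 add0r. Qed.

(** The Kumjian-Pask relations are homogeneous: the two sides have the same degree unless the
    right-hand side is 0. They therefore survive the attached shifts. *)
Lemma twist_family : KP_family twist_vertex (path_ghost_fun twist_path twist_ghost).
Proof.
apply: KP_family_build.
- exact: twist_path_idp.
- exact: twist_ghost_idp.
- by move=> v w; rewrite twistM addr0 (KP1 fam); case: ifP => // _; exact: twist0.
- move=> l m lm; rewrite /twist_path twistM (path_eltM fam)// deg_comp//.
  by rewrite -diffNkD addr0.
- move=> l m lm; rewrite /twist_ghost twistM (ghost_eltM fam)// deg_comp//.
  by rewrite -diffNkD addr0 (addrC (deg m)).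
- move=> n l m n0 ln mn; rewrite /twist_path /twist_ghost twistM -diffNkD.
  rewrite (KP3' fam n0 ln mn) addr0 add0r.
  by case: eqP => [<-|_]; [rewrite diffNk_id | exact: twist0].
- move=> v n n0; rewrite /twist_vertex (KP4' fam v n0).
  rewrite (@fsbig_morph A (endo_alg M) _ _ _ (twist^~ 0)).
  + by apply: eq_fsbigr => l _; rewrite twist_path_ghost diffNk_id.
  + exact: paths_le_at_finite.
  + exact: twist0.
  + exact: twistD.
Qed.

End GradedTwist.

(** * Existence and uniqueness of homogeneous components *)

Section Grading.
Variables (k : nat) (L : kgraph k) (R : comPzRingType) (K : nualgebra R).
Variables (p : vertex L -> K) (s : path_or_ghost L -> K).
Hypotheses (k_gt0 : (0 < k)%N) (rf : row_finite L) (fam : KP_family p s).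
Hypotheses (gen : generates (range p `|` range s)) (univ : KP_universal p s).
Implicit Types (f g : 'Z^k -> K) (x y : K) (n m : 'Z^k).

Definition decomposes x f :=
  [/\ forall n, KP_component p s n (f n), finite_set [set n | f n != 0] &
      x = \sum_(n \in [set: 'Z^k]) f n].

(** The decomposable elements form a submodule containing every monomial, and the monomials span. *)
Lemma decompose x : exists f, decomposes x f.
Proof.
have sub n : submodule (KP_component p s n) by exact: lspan_submodule.
have : lspan (monomials p s setT) x by rewrite lspan_monomials.
move: x; apply: (@lspan_min _ _ _ [set x | exists f, decomposes x f]); last first.
  move=> _ [a [b [_ ->]]]; set d := diffNk (deg a) (deg b).
  exists (fun n => if n == d then path_elt p s a ** ghost_elt p s b else 0); split.
  - move=> n; case: eqP => [->|_]; last by case: (sub n).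
    by apply: lspan_sub; exists a, b.
  - apply: (@sub_finite_set _ _ [set d]) => // n /=.
    by case: (n =P d) => // _; rewrite eqxx.
  - rewrite (@fsbigTE _ _ _ _ [fset d]%fset) ?big_seq_fset1 ?eqxx// => n.
    by rewrite in_fset1 => /negPf ->.
split=> /=.
- exists (fun=> 0); split=> [n||]; first by case: (sub n).
    by apply: (@sub_finite_set _ _ set0) => // n /=; rewrite eqxx.
  by rewrite fsbig1.
- move=> x y [f [fB ffin ->]] [g [gB gfin ->]]; exists (fun n => f n + g n).
  have Dfin : finite_set ([set n | f n != 0] `|` [set n | g n != 0]).
    by rewrite finite_setU.
  split=> [n||]; first by case: (sub n) => _ + _; apply.
    apply: sub_finite_set Dfin => n /=; apply: contra_neqP => /not_orP[].
    by move=> /negP/negPn/eqP -> /negP/negPn/eqP ->; rewrite addr0.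
  (* Over a common finite set containing both supports, the three sums become ordinary finite
     sums. *)
  pose D := fset_set ([set n | f n != 0] `|` [set n | g n != 0]).
  have nD n : n \notin D -> f n = 0 /\ g n = 0.
    rewrite in_fset_set// notin_setE => /not_orP[].
    by move=> /negP/negPn/eqP -> /negP/negPn/eqP ->.
  rewrite (@fsbigTE _ _ _ _ D f) => [|n /nD[]//].
  rewrite (@fsbigTE _ _ _ _ D g) => [|n /nD[]//].
  rewrite -big_split (@fsbigTE _ _ _ _ D)// => n /nD[-> ->].
  by rewrite addr0.
- move=> a x [f [fB ffin ->]]; exists (fun n => a *: f n).
  split=> [n||]; first by case: (sub n) => _ _; apply.
    apply: sub_finite_set ffin => n /=; apply: contra_neq => ->.
    by rewrite scaler0.
  have nD n : n \notin fset_set [set n | f n != 0] -> f n = 0.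
    by rewrite in_fset_set// notin_setE/= => /negP/negPn/eqP.
  rewrite (@fsbigTE _ _ _ _ (fset_set [set n | f n != 0]) f)// scaler_sumr.
  rewrite (@fsbigTE _ _ _ _ (fset_set [set n | f n != 0]))// => n /nD ->.
  by rewrite scaler0.
Qed.

(** The universal property, applied to the twisted family, gives h. It agrees with [twist x n] on
    monomials x of degree n, hence by linearity on their span. *)
Lemma twist_hom_exists : exists h : K -> endo_alg ('Z^k -> (R^o * K)%type),
  alg_hom h /\ forall n x, KP_component p s n x -> h x = twist x n.
Proof.
have [h [[hhom hp hs] _]] := univ (twist_family rf fam).
exists h; split=> // n; have [hlin hM] := hhom.
apply: (@lspan_min _ _ _ [set x | h x = twist x n]).
  split=> /= [|x y|a x]; first by rewrite (linear_for0 hlin) twist0.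
    by rewrite (linear_forD hlin) twistD => -> ->.
  by rewrite (linear_forZ hlin) twistZ => ->.
move=> _ [a [b [<- ->]]] /=; rewrite hM path_elt_map ghost_elt_map hp hs.
rewrite path_elt_fun; last exact: twist_path_idp.
rewrite ghost_elt_fun; last exact: twist_ghost_idp.
exact: twist_path_ghost.
Qed.

(** Any decomposition of x has the coefficients of [h x] as its components, and these depend on x
    alone. *)
Lemma decomposes_uniq x f g : decomposes x f -> decomposes x g -> f = g.
Proof.
have [h [[hlin _] hE]] := twist_hom_exists.
suff coef f' : decomposes x f' -> f' = coefficient (h x).
  by move=> /coef -> /coef ->.
move=> [fB ffin ->]; apply/funext => n.
(* The index n is added so that its term can be split off even when [f' n] is 0. *)
pose D := ([fset n] `|` fset_set [set n | f' n != 0])%fset.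
have nD m : m \notin D -> f' m = 0.
  rewrite inE negb_or in_fset_set// => /andP[_].
  by rewrite notin_setE/= => /negP/negPn/eqP.
rewrite (@fsbigTE _ _ _ _ D)//.
rewrite (big_morph (fun x => coefficient (h x) n) (id1 := 0) (op1 := +%R)); last 2 first.
- by move=> y z; rewrite (linear_forD hlin).
- by rewrite (linear_for0 hlin).
rewrite (big_fsetD1 n)/=; last by rewrite !inE eqxx.
rewrite (hE n)// coefficient_twist eqxx big1_fset ?addr0// => m.
rewrite !inE => /andP[mn _] _; rewrite (hE m)// coefficient_twist.
by rewrite eq_sym (negPf mn).
Qed.

Lemma KP_grading : is_grading (KP_component p s).
Proof.
split=> [n|m n x y|x]; first exact: lspan_submodule.
  exact: KP_componentM.
have [f fx] := decompose x; exists f; split=> // g.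
exact: decomposes_uniq.
Qed.

End Grading.

Theorem theorem3p7 (k : nat) (k_ge1 : (1 <= k)%N) (L : kgraph k)
    (L_locally_convex : locally_convex L) (L_row_finite : row_finite L)
    (R : comPzRingType) :
  exists (KP : nualgebra R) (p : vertex L -> KP) (s : path_or_ghost L -> KP),
    [/\ KP_family p s,
        generates (range p `|` range s),
        KP_universal p s,
        (forall (r : R) (v : vertex L), r != 0 -> r *: p v != 0) &
        is_grading (KP_component p s)].
Proof.
have fam := kp_family R L_row_finite.
have univ := @kp_universal k L R.
exists (kp_alg L R), (@kp_vertex k L R), (@kp_gen k L R); split=> //.
- exact: kp_generates.
- move=> r v; apply: KP_vertex_neq0 => //; exact: univ.
- apply: KP_grading => //; exact: kp_generates.
Qed.
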